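(* Let $X$ be a random variable with $\mathbb P(X=i)=p_i$ for $i=0,1,2,\dots$, $\sum_{i\ge0}p_i=1$, and let $F$ be its distribution function. Let $m\ge1$ be an integer, put $\theta=2m-1$, and assume $p_i>0$ for $i=0,1,\dots,2m-1$. Let $X_1,X_2,\dots$ be i.i.d. copies of $X$. For each $n\ge2$ let $G_n$ be the graph on $\{1,\dots,n\}$ with adjacency matrix $A_{ij}=1$ if $i\ne j$ and $X_i+X_j>\theta$, and $A_{ij}=0$ otherwise; and let $\widetilde G_n$ be the graph with self-loops on $\{1,\dots,n\}$ with adjacency matrix $\tilde A_{ij}=1$ if $X_i+X_j>\theta$ and $0$ otherwise (for all $i,j$, including $i=j$). Then, almost surely, as $n\to\infty$, \[ \mu_n(G_n)\to(1-F(m-1))\,\delta_{-1}+F(m-1)\,\delta_0\qquad\text{and}\qquad \widetilde\mu_n(\widetilde G_n)\to\delta_0 . \]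
   Context: For a graph (possibly with self-loops) on $n$ vertices, its spectral distribution is $\frac1n\sum_{i=1}^n\delta_{\mu_i}$ where $\mu_1,\dots,\mu_n$ are the eigenvalues with multiplicity of its adjacency matrix; $\mu_n(G_n)$ and $\widetilde\mu_n(\widetilde G_n)$ denote the spectral distributions of $G_n$ and $\widetilde G_n$. Convergence is weak convergence of probability measures. *)

(* Defs.v *)
From HB Require Import structures.
From mathcomp Require Import all_boot all_order all_algebra finmap.
From mathcomp Require Import polyrcf complex.
From mathcomp Require Import all_classical all_reals all_analysis.
Import numFieldNormedType.Exports.

Set Implicit Arguments.
Unset Strict Implicit.
Unset Printing Implicit Defensive.

Import Order.TTheory GRing.Theory Num.Theory.

Local Open Scope classical_set_scope.
Local Open Scope ring_scope.

(* The real eigenvalues of [A], each repeated according to its algebraic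
   multiplicity; for a symmetric matrix these are all [n] eigenvalues, see
   [char_poly_eigenvalues] and [size_eigenvalues]. *)
Definition eigenvalues (R : realType) n (A : 'M[R]_n) : seq R :=
  flatten [seq nseq (mup x (char_poly A)) x | x <- rootsR (char_poly A)].

Lemma char_poly_conj (C : fieldType) n (P D : 'M[C]_n) : P \in unitmx ->
  char_poly (invmx P *m D *m P) = char_poly D.
Proof.
move=> Pu; rewrite /char_poly /char_poly_mx !map_mxM.
set Q := map_mx polyC P; set Q' := map_mx polyC (invmx P).
have Q'Q : Q' *m Q = 1%:M by rewrite -map_mxM mulVmx// map_mx1.
have -> : 'X%:M - Q' *m map_mx polyC D *m Q =
    Q' *m ('X%:M - map_mx polyC D) *m Q.
  rewrite mulmxBr mulmxBl; congr (_ - _).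
  by rewrite mul_mx_scalar -scalemxAl Q'Q scalemx1.
by rewrite !det_mulmx mulrAC -det_mulmx Q'Q det1 mul1r.
Qed.

Lemma sym_char_poly_split (R : realType) n (A : 'M[R]_n) : A^T = A ->
  exists s : seq R, char_poly A = \prod_(x <- s) ('X - x%:P).
Proof.
move=> symA; set AC := map_mx (real_complex R) A.
have herm : AC \is hermsymmx.
  apply: realsym_hermsym.
    by apply/is_hermitianmxP; rewrite expr0 scale1r map_mx_id// /AC map_trmx symA.
  by apply/mxOverP => i j; rewrite mxE complex_real.
have real_d := hermitian_spectral_diag_real herm.
have /orthomx_spectralP AE := hermitian_normalmx herm.
set P := spectralmx AC in AE; set d := spectral_diag AC in AE real_d.
have Pu : P \in unitmx by apply: spectral_unit.
have charE : char_poly AC = \prod_(i < n) ('X - (d 0 i)%:P).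
  have -> : char_poly AC = char_poly (diag_mx d).
    rewrite [in LHS]AE char_poly_conj//.
  rewrite char_poly_trig ?diag_mx_is_trig//.
  by apply: eq_bigr => i _; rewrite mxE eqxx mulr1n.
exists [seq complex.Re (d 0 i) | i <- enum 'I_n].
apply: (@map_poly_inj _ _ (real_complex R)).
rewrite map_char_poly -/AC charE rmorph_prod big_map big_enum/=.
apply: eq_bigr => i _; rewrite map_polyXsubC.
have /mxOverP/(_ 0 i) := real_d.
by move=> /complex_realP[x ->].
Qed.

Lemma perm_eigenvalues (R : realType) n (A : 'M[R]_n) (s : seq R) :
  char_poly A = \prod_(x <- s) ('X - x%:P) -> perm_eq (eigenvalues A) s.
Proof.
move=> pE; apply/allP => x _ /=; apply/eqP.
have pN0 : char_poly A != 0 by rewrite monic_neq0 // char_poly_monic.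
rewrite -[RHS]mu_prod_XsubC -pE /eigenvalues.
rewrite count_flatten -map_comp.
under eq_map => y do rewrite /= count_nseq /=.
rewrite sumnE big_map.
have rootsP y : (y \in rootsR (char_poly A)) = root (char_poly A) y.
  by have := roots_on_rootsR pN0 y; rewrite in_itv /= => <-.
have [xr|xNr] := boolP (x \in rootsR (char_poly A)).
  rewrite (bigD1_seq x) //= ?uniq_roots// eqxx mul1n big1 ?addn0// => y yx.
  by rewrite (negbTE yx).
rewrite (mupNroot (x := x)) -?rootsP// big_seq big1// => y yr.
by case: eqP => [yx|]; rewrite ?mul0n// -yx yr in xNr.
Qed.

Lemma char_poly_eigenvalues (R : realType) n (A : 'M[R]_n) : A^T = A ->
  char_poly A = \prod_(x <- eigenvalues A) ('X - x%:P).
Proof.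
move=> /sym_char_poly_split[s sE]; rewrite sE.
by apply: perm_big; rewrite perm_sym perm_eigenvalues.
Qed.

Lemma size_eigenvalues (R : realType) n (A : 'M[R]_n) : A^T = A ->
  size (eigenvalues A) = n.
Proof.
move=> /char_poly_eigenvalues/(congr1 (fun p : {poly R} => size p)).
by rewrite size_char_poly size_prod_XsubC => -[].
Qed.

Definition spectral_distribution (R : realType) n (A : 'M[R]_n) :
    {measure set R -> \bar R} :=
  mscale (n%:R^-1)%:nng
    (msum (fun k => \d_((eigenvalues A)`_k)) (size (eigenvalues A))).

Lemma spectral_distribution_setT (R : realType) n (A : 'M[R]_n) :
  (0 < n)%N -> A^T = A -> spectral_distribution A setT = 1%E.
Proof.
move=> n0 /size_eigenvalues sA; rewrite /spectral_distribution /= sA /mscale /=.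
rewrite [X in (_ * X)%E](_ : _ = (\sum_(k < n) 1)%E); last first.
  by apply: eq_bigr => k _; exact: diracT.
by rewrite sumEFin sumr_const card_ord -EFinM mulVf// pnatr_eq0 -lt0n.
Qed.

(* Weak convergence; [R] carries its Borel sigma-algebra. *)
Definition weak_cvg (R : realType) (mu : nat -> {measure set R -> \bar R})
    (nu : {measure set R -> \bar R}) : Prop :=
  forall f : R -> R, continuous f -> (exists M, forall x, `|f x| <= M) ->
    (\int[mu n]_x (f x)%:E)%E @[n --> \oo] --> (\int[nu]_x (f x)%:E)%E.

Lemma fine_cdf_ge0 d (T : measurableType d) (R : realType)
  (P : probability T R) (X : {RV P >-> R}) r : 0 <= fine (cdf X r).
Proof. exact/fine_ge0/cdf_ge0. Qed.

Lemma fine_cdf_le1 d (T : measurableType d) (R : realType)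
  (P : probability T R) (X : {RV P >-> R}) r : fine (cdf X r) <= 1.
Proof.
by rewrite -lee_fin fineK ?cdf_le1// /cdf fin_num_measure.
Qed.

Definition cdf01 d (T : measurableType d) (R : realType)
    (P : probability T R) (X : {RV P >-> R}) (r : R) : {i01 R} :=
  Itv01 (fine_cdf_ge0 X r) (fine_cdf_le1 X r).

(* The mixture [(1 - t) \d_a + t \d_b]. *)
Definition two_point (R : realType) (t : {i01 R}) (a b : R) :
    {measure set R -> \bar R} :=
  measure_add (mscale (1 - t%:num)%:nng \d_a) (mscale t%:num%:nng \d_b).

Definition mutually_independent d (T : measurableType d) (R : realType)
    (P : probability T R) (I : choiceType) (X : I -> {RV P >-> R}) : Prop :=
  forall (J : {fset I}) (B : I -> set R), (forall j, measurable (B j)) ->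
    (P (\bigcap_(j in [set` J]) (X j @^-1` B j)) =
     \prod_(j <- J) P (X j @^-1` B j))%E.

Definition same_law d (T : measurableType d) (R : realType)
    (P : probability T R) (X Y : {RV P >-> R}) : Prop :=
  forall B : set R, measurable B -> distribution P X B = distribution P Y B.

Definition adjacency_matrix (R : realType) n (e : rel 'I_n) : 'M[R]_n :=
  \matrix_(i, j) (e i j)%:R.

(* The vertex [i : 'I_n] (numbered from 0) has weight [x i]. *)
Definition threshold_graph (R : realType) (theta : R) (x : nat -> R) n :
    rel 'I_n :=
  [rel i j : 'I_n | (i != j) && (theta < x i + x j)].

Definition threshold_graph_loops (R : realType) (theta : R) (x : nat -> R) n :
    rel 'I_n :=
  [rel i j : 'I_n | theta < x i + x j].

Definition graph_spectral_distribution (R : realType) n (e : rel 'I_n) :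
    {measure set R -> \bar R} :=
  spectral_distribution (adjacency_matrix R e).

(* Main.v *)
Require Import Defs.
From HB Require Import structures.
From mathcomp Require Import all_boot all_order all_algebra finmap.
From mathcomp Require Import all_classical all_reals all_analysis.
From mathcomp Require Import ring lra zify.
From mathcomp Require Import measurable_realfun.
Import numFieldNormedType.Exports.
Import Order.TTheory GRing.Theory Num.Theory.
Local Open Scope classical_set_scope.
Local Open Scope ring_scope.

(* Almost surely all weights are natural numbers, and then the row of a vertex
   in the adjacency matrix B with loops only depends on its weight truncated at
   2m: B has rank at most 2m + 1.  The loopless matrix is A = B - D with D the
   diagonal indicator of the weights >= m, so that, up to 2m + 1, the rank of A
   is at most the number of weights >= m, and the rank of A + 1 at most the
   number N of weights < m.  Hence all but O(m) eigenvalues of A are 0 (about N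
   of them) or -1 (about n - N), and N / n tends to F(m - 1) by the strong law
   of large numbers for pairwise independent events, which follows from the
   second moment along the squares. *)

(** * Rank deficiency and multiplicity of eigenvalues *)

(** With [B = A - a] of rank [r] written as [L * pid_mx r * U], [L] and [U] invertible, the matrix
    [X - A = y - B] equals [L * (y L^-1 U^-1 - pid_mx r) * U]. The rows of index at least [r] of the
    middle factor are multiples of [y = X - a], and each contributes a factor [y] to the
    determinant. *)
Lemma dvdp_char_poly_rank (F : fieldType) n (A : 'M[F]_n) (a : F) :
  ('X - a%:P) ^+ (n - \rank (A - a%:M)) %| char_poly A.
Proof.
set B := A - a%:M; set r := \rank B; set y : {poly F} := 'X - a%:P.
pose L := map_mx polyC (col_ebase B); pose U := map_mx polyC (row_ebase B).
pose L' := map_mx polyC (invmx (col_ebase B)).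
pose U' := map_mx polyC (invmx (row_ebase B)).
have LL' : L *m L' = 1%:M by rewrite -map_mxM mulmxV ?col_ebase_unit// map_mx1.
have U'U : U' *m U = 1%:M by rewrite -map_mxM mulVmx ?row_ebase_unit// map_mx1.
(* [diag_mx e *m M] is that middle factor, with the [y] of every row of index at least [r] moved
   into [e]. *)
pose M : 'M[{poly F}]_n := \matrix_(i, j)
  if (i < r)%N then y * (L' *m U') i j - (pid_mx r : 'M[_]_n) i j else (L' *m U') i j.
pose e : 'rV[{poly F}]_n := \row_i if (i < r)%N then 1 else y.
have charE : char_poly_mx A = L *m (diag_mx e *m M) *m U.
  have -> : diag_mx e *m M = y *: (L' *m U') - pid_mx r.
    apply/matrixP => i j; rewrite mul_diag_mx !mxE; case: ifPn => ir.
      by rewrite mul1r.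
    by rewrite andbF subr0.
  rewrite mulmxBr mulmxBl -scalemxAr -scalemxAl mulmxA LL' mul1mx U'U scalemx1.
  have -> : L *m pid_mx r *m U = map_mx polyC B.
    by rewrite -[in RHS](mulmx_ebase B) !map_mxM map_pid_mx.
  by rewrite /char_poly_mx /B map_mxB map_scalar_mx /= /y raddfB /= opprB addrA subrK.
rewrite /char_poly charE !det_mulmx det_diag -!mulrA; apply: dvdp_mull.
apply: dvdp_mulr.
rewrite (bigID (fun i : 'I_n => i < r)%N) /=; apply: dvdp_mull.
rewrite (eq_bigr (fun=> y)) => [|i /negbTE]; last by rewrite mxE => ->.
have rn : (r <= n)%N by exact: rank_leq_row.
rewrite -(big_mkord (fun i => ~~ (i < r)%N) (fun=> y)) (big_cat_nat (leq0n _) rn) /=.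
rewrite [X in X * _]big_nat_cond big_pred0 ?mul1r => [|i]; last first.
  by rewrite /=; case: ltnP => // ->; rewrite andbF.
rewrite big_nat_cond (eq_bigl (fun i => r <= i < n)%N) => [|i].
  by rewrite -big_nat prodr_const_nat.
by rewrite -leqNgt andbAC andbb.
Qed.

(** This turns an upper bound on a rank into a lower bound on the mass of an atom. Symmetry makes
    the characteristic polynomial split over the reals, so that [count_mem] is the multiplicity of
    the root [a]. *)
Lemma leq_rank_count_eigenvalues (R : realType) n (A : 'M[R]_n) (a : R) :
  A^T = A -> (n <= count_mem a (eigenvalues A) + \rank (A - a%:M)%R)%N.
Proof.
move=> symA; rewrite addnC -leq_subLR -mu_prod_XsubC -char_poly_eigenvalues//.
by rewrite mup_geq ?monic_neq0 ?char_poly_monic// dvdp_char_poly_rank.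
Qed.

(** A diagonal matrix is a sum of matrices of rank at most one, one for each nonzero entry, and rank
    is subadditive. *)
Lemma mxrank_diag_le (F : fieldType) n (d : 'rV[F]_n) :
  (\rank (diag_mx d) <= #|[pred i | (d 0 i != 0)%R]|)%N.
Proof.
rewrite diag_mx_sum_delta -sum1_card (bigID (fun i => d 0 i != 0)) /=.
rewrite [X in (_ + X)%R]big1 ?addr0 => [|i]; last first.
  by rewrite negbK => /eqP ->; rewrite scale0r.
elim/big_ind2 : _ => [|q B q' B' qB qB'|i _].
- by rewrite mxrank0.
- by rewrite (leq_trans (mxrank_add _ _))// leq_add.
- by rewrite (leq_trans (mxrank_scale _ _))// mxrank_delta.
Qed.

(** * Ranks of the adjacency matrices for natural weights *)

Section threshold_rank.
Variables (R : realType) (m n : nat) (k : nat -> nat).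
Hypothesis m_gt0 : (0 < m)%N.

Let theta : R := (2 * m - 1)%N%:R.
Let x i : R := (k i)%:R.
Let loops := adjacency_matrix R (@threshold_graph_loops R theta x n).
Let noloop := adjacency_matrix R (@threshold_graph R theta x n).

(** For integers, exceeding [2m - 1] means reaching [2m]; [0 < m] makes the truncated subtraction
    exact. *)
Lemma threshold_natE i j : (theta < x i + x j) = (2 * m <= k i + k j)%N.
Proof. by rewrite /theta /x -natrD ltr_nat ltn_subLR ?add1n ?ltnS// muln_gt0. Qed.

Lemma threshold_loops_sym : loops^T = loops.
Proof. by apply/matrixP => i j; rewrite !mxE /threshold_graph_loops /= addrC. Qed.

Lemma threshold_sym : noloop^T = noloop.
Proof. by apply/matrixP => i j; rewrite !mxE /threshold_graph /= addrC eq_sym. Qed.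

(* The row of vertex [i] only depends on [minn (k i) (2 * m)]. *)
Lemma mxrank_threshold_loops : (\rank loops <= (2 * m).+1)%N.
Proof.
(* Factorization through the [2m + 1] truncated weights: [C] sends a vertex to its truncated weight,
   [D] lists the row belonging to each of them. *)
pose C : 'M[R]_(n, (2 * m).+1) := \matrix_(i, t) (minn (k i) (2 * m) == t)%:R.
pose D : 'M[R]_((2 * m).+1, n) := \matrix_(t, j) (2 * m <= t + k j)%N%:R.
suff -> : loops = C *m D by rewrite mulmx_max_rank.
apply/matrixP => i j; rewrite !mxE /threshold_graph_loops /= threshold_natE.
have lt_min : (minn (k i) (2 * m) < (2 * m).+1)%N by rewrite ltnS geq_minr.
rewrite (bigD1 (Ordinal lt_min))//= !mxE eqxx mul1r big1 ?addr0 => [|t tN]; last first.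
  by rewrite !mxE [_ == _ :> nat]eq_sym [_ == _](negbTE tN) mul0r.
rewrite /=; have -> // : (2 * m <= k i + k j)%N = (2 * m <= minn (k i) (2 * m) + k j)%N.
by lia.
Qed.

(** Vertex [i] carries a loop exactly when [2 k_i >= 2m], that is [k_i >= m]. *)
Lemma threshold_noloopE :
  noloop = loops - diag_mx (\row_(i < n) (m <= k i)%N%:R).
Proof.
apply/matrixP => i j; rewrite !mxE /threshold_graph /threshold_graph_loops /=.
have [<-|ij] /= := eqVneq i j; last by rewrite mulr0n subr0.
by rewrite threshold_natE mulr1n addnn -mul2n leq_pmul2l// subrr.
Qed.

Lemma mxrank_threshold0 :
  (\rank (noloop - 0%:M)%R <= (2 * m).+1 + #|[pred i : 'I_n | m <= k i]|)%N.
Proof.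
rewrite raddf0 subr0 threshold_noloopE (leq_trans (mxrank_add _ _))//.
rewrite leq_add ?mxrank_threshold_loops// mxrank_opp.
rewrite (leq_trans (mxrank_diag_le _ _ _))// subset_leq_card//.
by apply/fintype.subsetP => i; rewrite !inE mxE pnatr_eq0 eqb0 negbK.
Qed.

Lemma mxrank_thresholdN1 :
  (\rank (noloop - (-1)%:M)%R <= (2 * m).+1 + #|[pred i : 'I_n | k i < m]|)%N.
Proof.
rewrite raddfN/= opprK threshold_noloopE -addrA (leq_trans (mxrank_add _ _))//.
rewrite leq_add ?mxrank_threshold_loops//.
(* Adding the identity to minus the indicator of [k_i >= m] leaves the indicator of [k_i < m]. *)
rewrite (_ : _ + _ = diag_mx (\row_(i < n) (k i < m)%N%:R)); last first.
  apply/matrixP => i j; rewrite !mxE.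
  have [_|_] := eqVneq i j; last by rewrite !mulr0n oppr0 add0r.
  by rewrite !mulr1n ltnNge; case: leqP; rewrite ?addNr ?oppr0 ?add0r.
rewrite (leq_trans (mxrank_diag_le _ _ _))// subset_leq_card//.
by apply/fintype.subsetP => i; rewrite !inE mxE pnatr_eq0 eqb0 negbK.
Qed.

End threshold_rank.

(** * Sums over lists concentrated on two values *)

(** Since [a] and [b] differ, their counts add up to at most [size s]. The two lower bounds
    therefore also give upper bounds: each count is within [K] of its target, and at most [2K]
    entries are neither [a] nor [b]. *)
Lemma sum_two_atoms (R : realType) (f : R -> R) (M a b : R) (s : seq R)
    (N K : nat) : (forall x, `|f x| <= M) -> a != b ->
  (N <= size s)%N -> (N <= count_mem b s + K)%N ->
  (size s <= count_mem a s + (K + N))%N ->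
  `|\sum_(x <- s) f x - (N%:R * f b + (size s - N)%N%:R * f a)| <= K%:R * M *+ 4.
Proof.
move=> fM ab Ns hb ha.
have M0 : 0 <= M by exact: le_trans (fM 0).
(* By induction on [s]: every entry other than [a] and [b] costs at most [M]. *)
have [cs rest] : (count_mem a s + count_mem b s <= size s)%N /\
    `|\sum_(x <- s) f x - (count_mem b s)%:R * f b - (count_mem a s)%:R * f a| <=
    M * (size s - (count_mem a s + count_mem b s))%N%:R.
  elim: s {Ns hb ha} => [|y s [ih1 ih2]].
    by rewrite big_nil !mul0r !subr0 normr0 mulr0.
  rewrite big_cons /=; split.
    have [->|ya] := eqVneq y a.
      by rewrite /= ?eqxx (negbTE ab) add0n add1n addSn ltnS.
    rewrite /= ?(negbTE ya) add0n.
    by case: eqVneq => _; rewrite ?add0n ?add1n ?addnS ?ltnS// leqW.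
  have [->|ya] := eqVneq y a.
    rewrite /= ?eqxx (negbTE ab) add0n add1n -(addn1 (count_mem a s)) natrD mulrDl mul1r.
    rewrite addnAC addn1 subSS.
    rewrite [X in `|X|](_ : _ = \sum_(x <- s) f x - (count_mem b s)%:R * f b -
      (count_mem a s)%:R * f a)//; ring.
  have [->|yb] := eqVneq y b.
    rewrite /= ?(negbTE ya) ?eqxx add0n add1n -(addn1 (count_mem b s)) natrD mulrDl mul1r.
    rewrite addnA addn1 subSS.
    rewrite [X in `|X|](_ : _ = \sum_(x <- s) f x - (count_mem b s)%:R * f b -
      (count_mem a s)%:R * f a)//; ring.
  rewrite /= ?(negbTE ya) ?(negbTE yb) !add0n subSn// -natr1 mulrDr mulr1.
  rewrite [X in `|X|](_ : _ = (\sum_(x <- s) f x - (count_mem b s)%:R * f b -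
    (count_mem a s)%:R * f a) + f y); last by ring.
  by rewrite (le_trans (ler_normD _ _))// lerD.
set ca := count_mem a s in ha cs rest *; set cb := count_mem b s in hb cs rest *.
have h1 (u v : nat) (y : R) : (u <= v + K)%N -> (v <= u + K)%N ->
    `|u%:R * f y - v%:R * f y| <= K%:R * M.
  move=> uv vu; rewrite -mulrBl normrM ler_pM// ler_norml; apply/andP; split.
    by rewrite lerNl opprB lerBlDl -natrD ler_nat.
  by rewrite lerBlDl -natrD ler_nat.
rewrite [X in `|X|](_ : _ = (\sum_(x <- s) f x - cb%:R * f b - ca%:R * f a) +
  ((cb%:R * f b - N%:R * f b) + (ca%:R * f a - (size s - N)%N%:R * f a))); last by ring.
rewrite (le_trans (ler_normD _ _))//.
(* Error budget: [2KM] for the remaining entries, and [KM] for the count of each of the two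
   atoms. *)
rewrite (_ : _ *+ 4 = K%:R * M *+ 2 + K%:R * M *+ 2); last by ring.
apply: lerD.
  rewrite (le_trans rest)// (_ : _ *+ 2 = M * (2 * K)%N%:R); last by rewrite natrM; ring.
  by rewrite ler_wpM2l// ler_nat; lia.
by rewrite (le_trans (ler_normD _ _))// mulr2n lerD// h1//; lia.
Qed.

(** * Integrals against finite sums of Dirac masses *)

Lemma ge0_integral_spectral_distribution (R : realType) n (A : 'M[R]_n)
    (f : R -> R) : (forall x, 0 <= f x) -> measurable_fun setT f ->
  (\int[spectral_distribution A]_x (f x)%:E =
   (n%:R^-1 * \sum_(x <- eigenvalues A) f x)%:E)%E.
Proof.
move=> f0 mf; rewrite /spectral_distribution ge0_integral_mscale//; last 2 first.
- exact/measurable_EFinP.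
- by move=> x _; rewrite lee_fin.
rewrite ge0_integral_measure_sum//; last 2 first.
- by move=> x _; rewrite lee_fin.
- exact/measurable_EFinP.
rewrite EFinM; congr (_ * _)%E.
rewrite (big_nth 0) big_mkord -sumEFin; apply: eq_bigr => i _.
by rewrite integral_dirac ?diracT ?mul1e//; exact/measurable_EFinP.
Qed.

Lemma ge0_integral_two_point (R : realType) (t : {i01 R}) (a b : R)
    (f : R -> R) : (forall x, 0 <= f x) -> measurable_fun setT f ->
  (\int[two_point t a b]_x (f x)%:E =
   ((1 - t%:num) * f a + t%:num * f b)%:E)%E.
Proof.
move=> f0 mf.
have f0' x : setT x -> (0%R <= (f x)%:E)%E by rewrite lee_fin.
have mf' : measurable_fun setT (EFin \o f) by exact/measurable_EFinP.
rewrite /two_point ge0_integral_measure_add// !ge0_integral_mscale//.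
by rewrite !integral_dirac// !diracT !mul1e.
Qed.

(** Apply the nonnegative case to the positive and negative parts of [f]. As [L] takes real values,
    both integrals are finite and their difference is meaningful. *)
Lemma integral_from_ge0 (R : realType) (mu : {measure set R -> \bar R})
    (L : (R -> R) -> R) :
  (forall f g, L (f \- g) = L f - L g) ->
  (forall f : R -> R, (forall x, 0 <= f x) -> measurable_fun setT f ->
     (\int[mu]_x (f x)%:E)%E = (L f)%:E) ->
  forall f : R -> R, measurable_fun setT f ->
     (\int[mu]_x (f x)%:E = (L f)%:E)%E.
Proof.
move=> LB Lge0 f mf; rewrite integralE.
rewrite -[fun x => (f x)%:E]/(EFin \o f) funerpos funerneg !Lge0//; first last.
- exact: measurable_funrpos.
- exact: measurable_funrneg.
by rewrite -EFinB -LB; congr (L _)%:E; exact: funrposBneg.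
Qed.

Lemma integral_spectral_distribution (R : realType) n (A : 'M[R]_n)
    (f : R -> R) : measurable_fun setT f ->
  (\int[spectral_distribution A]_x (f x)%:E =
   (n%:R^-1 * \sum_(x <- eigenvalues A) f x)%:E)%E.
Proof.
apply: (@integral_from_ge0 _ _ (fun f => n%:R^-1 * \sum_(x <- _) f x)) => g.
  by move=> h; rewrite -mulrBr -sumrB.
exact: ge0_integral_spectral_distribution.
Qed.

Lemma integral_two_point (R : realType) (t : {i01 R}) (a b : R) (f : R -> R) :
  measurable_fun setT f ->
  (\int[two_point t a b]_x (f x)%:E =
   ((1 - t%:num) * f a + t%:num * f b)%:E)%E.
Proof.
apply: (@integral_from_ge0 _ _ (fun f => (1 - t%:num) * f a + t%:num * f b)) => g.
  by move=> h /=; ring.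
exact: ge0_integral_two_point.
Qed.

(** * Series, and convergence along the squares *)

Lemma nneseries_lty_cvg0 (R : realType) (u : nat -> R) :
  (forall k, 0 <= u k) -> (\sum_(k <oo) (u k)%:E < +oo)%E -> u @ \oo --> 0.
Proof.
move=> u0 uoo; apply: cvg_series_cvg_0; apply: nondecreasing_is_cvgn.
  by apply/nondecreasing_seqP => n; rewrite seriesSr lerDl.
set M := (\sum_(k <oo) _)%E in uoo.
have M0 : (0 <= M)%E by apply: nneseries_ge0 => k _ _; rewrite lee_fin.
exists (fine M) => _ [n _ <-]; rewrite -lee_fin fineK ?ge0_fin_numE//.
rewrite /series /= -sumEFin; apply: nneseries_lim_ge => k _ _.
by rewrite lee_fin.
Qed.

Lemma nneseries_inv_sqr_lty (R : realType) :
  (\sum_(k <oo) (k.+1%:R ^- 2 : R)%:E < +oo)%E.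
Proof.
apply: (@le_lt_trans _ _ 2%:E); last exact: ltry.
apply: lime_le; first by apply: is_cvg_nneseries => k _ _; rewrite lee_fin.
apply: nearW => n; rewrite big_mkord sumEFin lee_fin.
(* This telescoping majorant is inductive: the step has slack [n / ((n+1)^2 (n+2))]. *)
suff : \sum_(k < n) k.+1%:R ^- 2 <= 2 - 2 / n.+1%:R :> R.
  by move/le_trans; apply; rewrite lerBlDr lerDl divr_ge0.
elim: n => [|n ih]; first by rewrite big_ord0 divr1 subrr.
rewrite big_ord_recr /= (le_trans (lerD ih (lexx _)))//.
have n1 : (0 : R) < n.+1%:R by rewrite ltr0n.
have n2 : (0 : R) < n.+2%:R by rewrite ltr0n.
rewrite -subr_ge0 (_ : _ - _ = n%:R / (n.+1%:R ^+ 2 * n.+2%:R)); last first.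
  rewrite -[in n.+2%:R]natr1 -!natr1.
  have ? : n%:R + 1 != 0 :> R by rewrite natr1 gt_eqF.
  have ? : n%:R + 1 + 1 != 0 :> R by rewrite !natr1 gt_eqF.
  by field; apply/andP.
by rewrite divr_ge0// mulr_ge0// ltW// exprn_gt0.
Qed.

Lemma sqr_interval (n : nat) : exists k, (k ^ 2 <= n < k.+1 ^ 2)%N.
Proof.
elim: n => [|n [k /andP[kn nk]]]; first by exists 0%N.
have [lt|ge] := ltnP n.+1 (k.+1 ^ 2)%N; first by exists k; rewrite lt (leq_trans kn).
by exists k.+1; rewrite ge/=; nia.
Qed.

(* Consecutive squares [k^2, (k+1)^2] are only [2k + 1 = o(k^2)] apart. *)
Lemma cvg_from_squares (R : realType) (u : nat -> R) :
  (forall n, `|u n.+1 - u n| <= 1) ->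
  (k.+1%:R ^- 2 * u (k.+1 ^ 2)%N) @[k --> \oo] --> 0 ->
  (n%:R^-1 * u n) @[n --> \oo] --> 0.
Proof.
move=> u1 /cvgr0Pnorm_le ucvg; apply/cvgr0Pnorm_le => e e0.
have e2 : 0 < e / 2 by rewrite divr_gt0.
have [K _ uK] := ucvg _ e2.
(* Chosen so that [k + 1 >= L] gives [4 <= e (k+1)], hence [2 (k+1) <= (e/2) (k+1)^2]. *)
pose L := (Num.truncn (4 / e)).+1.
have uD n j : `|u (n + j)%N - u n| <= j%:R.
  elim: j => [|j ih]; first by rewrite addn0 subrr normr0.
  rewrite addnS -natr1 -(subrKA (u (n + j)%N)) addrC (le_trans (ler_normD _ _))//.
  by rewrite lerD// distrC.
exists ((K + L).+1 ^ 2)%N => // n /= Kn.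
(* The integer square root of [n] is positive, so it is written [k.+1]; then
   [n - (k+1)^2 <= 2 (k+1)]. *)
have [[|k] /andP[kn nk]] := sqr_interval n; first by nia.
have Kk : (K + L <= k)%N by nia.
have k0 : (0 : R) < k.+1%:R by rewrite ltr0n.
have n0 : (0 : R) < n%:R by rewrite ltr0n; nia.
rewrite normrM ger0_norm ?invr_ge0 ?(ltW n0)// ler_pdivrMl//.
have uk : `|u (k.+1 ^ 2)%N| <= e / 2 * k.+1%:R ^+ 2.
  have := uK k (leq_trans (leq_addr _ _) Kk).
  rewrite /= normrM ger0_norm ?invr_ge0 ?exprn_ge0 ?(ltW k0)//.
  by rewrite ler_pdivrMl ?exprn_gt0// mulrC.
have := uD (k.+1 ^ 2)%N (n - k.+1 ^ 2)%N; rewrite subnKC// => un.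
have Lk : 4 <= e * k.+1%:R.
  rewrite mulrC -ler_pdivrMr// ltW// (lt_le_trans (truncnS_gt _))// ler_nat.
  by rewrite (leq_trans _ (leqW Kk))// leq_addl.
have jk : (n - k.+1 ^ 2)%N%:R <= 2 * k.+1%:R :> R.
  by rewrite -natrM ler_nat leq_subLR -ltnS (leq_trans nk)// -!mulnn; nia.
have nk' : k.+1%:R ^+ 2 <= n%:R :> R by rewrite -natrX ler_nat.
(* In total [|u n| <= 2 (k+1) + (e/2) (k+1)^2 <= e (k+1)^2 <= e n]. *)
rewrite -(subrK (u (k.+1 ^ 2)%N) (u n)) (le_trans (ler_normD _ _))//.
rewrite (le_trans (lerD un uk))//.
nra.
Qed.

(** * Strong law of large numbers for pairwise independent events *)

Section pairwise_independent_events.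
Context d (T : measurableType d) (R : realType) (P : probability T R).
Variables (A : nat -> set T) (q : R).
Hypothesis mA : forall i, measurable (A i).
Hypothesis PA : forall i, P (A i) = q%:E.
Hypothesis PAA : forall i j, i != j -> P (A i `&` A j) = (q * q)%:E.

Let S n (w : T) : R := \sum_(i < n) \1_(A i) w.

Let mS n : measurable_fun setT (S n).
Proof. by apply: measurable_sum => i; exact: measurable_indic. Qed.

Let S_ge0 n w : 0 <= S n w.
Proof. by apply: sumr_ge0 => i _; rewrite indicE. Qed.

Let q_ge0 : 0 <= q.
Proof. by rewrite -lee_fin -(PA 0). Qed.

Let int_sum n (g : nat -> T -> R) (c : nat -> R) :
  (forall i, measurable_fun setT (g i)) -> (forall i w, 0 <= g i w) ->
  (forall i, (\int[P]_w (g i w)%:E)%E = (c i)%:E) ->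
  (\int[P]_w (\sum_(i < n) g i w)%:E)%E = (\sum_(i < n) c i)%:E.
Proof.
move=> mg g0 gc; under eq_integral do rewrite -sumEFin.
rewrite ge0_integral_sum//.
- by rewrite -sumEFin; apply: eq_bigr => i _.
- by move=> i; exact/measurable_EFinP.
- by move=> i w _; rewrite lee_fin.
Qed.

Let int_S n : (\int[P]_w (S n w)%:E)%E = (n%:R * q)%:E.
Proof.
rewrite (@int_sum n (fun i => \1_(A i) : T -> R) (fun=> q))//.
- by rewrite sumr_const card_ord mulr_natl.
- by move=> i; rewrite integral_indic// setIT; exact: PA.
Qed.

(** The square expands into [n] diagonal terms of mean [q], an indicator being its own square, and
    [n^2 - n] off-diagonal terms of mean [q^2] by pairwise independence. *)
Let int_SS n : (\int[P]_w (S n w ^+ 2)%:E)%E =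
  (n%:R * q + (n%:R ^+ 2 - n%:R) * q ^+ 2)%:E.
Proof.
have mI i j : measurable (A i `&` A j) by exact: measurableI.
under eq_integral.
  move=> w _; rewrite expr2 /S mulr_suml.
  under eq_bigr do rewrite mulr_sumr.
  over.
rewrite (@int_sum n (fun i w => \sum_(j < n) \1_(A i) w * \1_(A j) w)
  (fun i => \sum_(j < n) if i == j then q else q ^+ 2)).
- congr EFin; rewrite (eq_bigr (fun=> q + (n%:R - 1) * q ^+ 2)) => [|i _].
    by rewrite sumr_const card_ord -mulr_natl; ring.
  rewrite (bigD1 i)//= eqxx (eq_bigr (fun=> q ^+ 2)) => [|j ji]; last first.
    by rewrite eq_sym -[_ == _]/(j == i) (negbTE ji).
  rewrite sumr_const cardC1 card_ord -subn1 -[_ *+ _]mulr_natl natrB//.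
  by rewrite (leq_ltn_trans _ (ltn_ord i)).
- move=> i; apply: measurable_sum => j.
  by apply: measurable_funM; exact: measurable_indic.
- by move=> i w; apply: sumr_ge0 => j _; rewrite !indicE -natrM.
- move=> i; apply: (@int_sum n (fun j w => \1_(A i) w * \1_(A j) w)
    (fun j => if i == j then q else q ^+ 2)) => [j|j w|j].
  + by apply: measurable_funM; exact: measurable_indic.
  + by rewrite !indicE -natrM.
  + have <- : P (A i `&` A j) = (if i == j then q else q ^+ 2)%:E.
      by case: eqVneq => [->|]; rewrite ?setIid ?expr2; [exact: PA|exact: PAA].
    under eq_integral do rewrite -[_ * _]/((\1_(A i) \* \1_(A j)) _) -indicI.
    by rewrite integral_indic// setIT.
Qed.

(* Expanding the square, with the cross term moved to the left so that every
   integrand is nonnegative. *)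
Lemma second_moment_frequency n :
  (\int[P]_w ((S n w - n%:R * q) ^+ 2)%:E)%E = (n%:R * (q - q ^+ 2))%:E.
Proof.
have nq0 : 0 <= 2 * n%:R * q by rewrite !mulr_ge0.
have mZ : measurable_fun setT (fun w => 2 * n%:R * q * S n w).
  exact: measurable_funM.
have mSS : measurable_fun setT (fun w => S n w ^+ 2) by exact: measurable_funX.
have mD : measurable_fun setT (fun w => (S n w - n%:R * q) ^+ 2).
  by apply: measurable_funX; exact: measurable_funB.
have intc c : (\int[P]_w (cst c w)%:E = c%:E)%E.
  rewrite (_ : (fun w => _) = cst c%:E)// integral_cst//.
  by rewrite [X in (_ * X)%E]probability_setT mule1.
have : (\int[P]_w ((S n w - n%:R * q) ^+ 2)%:E +
     \int[P]_w (2 * n%:R * q * S n w)%:E =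
  \int[P]_w (S n w ^+ 2)%:E + \int[P]_w (cst (n%:R ^+ 2 * q ^+ 2) w)%:E)%E.
  rewrite -!ge0_integralD//; first last.
  - exact/measurable_EFinP.
  - by move=> w _; rewrite lee_fin mulr_ge0.
  - exact/measurable_EFinP.
  - by move=> w _; rewrite lee_fin sqr_ge0.
  - exact/measurable_EFinP.
  - by move=> w _; rewrite lee_fin mulr_ge0// sqr_ge0.
  - exact/measurable_EFinP.
  - by move=> w _; rewrite lee_fin sqr_ge0.
  by apply: eq_integral => w _; rewrite -!EFinD; congr EFin => /=; ring.
rewrite int_SS intc.
under [X in (_ + X)%E]eq_integral do rewrite EFinM.
rewrite ge0_integralZl//; first last.
- by move=> w _; rewrite lee_fin.
- exact/measurable_EFinP.
rewrite int_S -EFinM.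
(* The identity itself excludes an infinite integral, all its other terms being finite. *)
case: (\int[P]_w ((S n w - n%:R * q) ^+ 2)%:E)%E => [r||] // [rE].
by congr EFin; move: rE; lra.
Qed.

(* The squared deviations along the squares [k ^ 2] have summable integrals. *)
Lemma slln_events :
  {ae P, forall w, (n%:R^-1 * \sum_(i < n) \1_(A i) w) @[n --> \oo] --> q}.
Proof.
pose u w n := S n w - n%:R * q.
pose Y k w := (k.+1%:R ^- 2 * u w (k.+1 ^ 2)%N) ^+ 2.
have mY k : measurable_fun setT (Y k).
  by apply: measurable_funX; apply: measurable_funM => //; exact: measurable_funB.
have Y0 k w : 0 <= Y k w by exact: sqr_ge0.
have q0 := q_ge0.
have q1 : q <= 1 by rewrite -lee_fin -(PA 0) probability_le1.
(* The integral is [(k+1)^-4 * (k+1)^2 * (q - q^2)], and [q - q^2 <= 1]. *)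
have intY k : (\int[P]_w (Y k w)%:E <= (k.+1%:R ^- 2)%:E)%E.
  rewrite /Y; under eq_integral do rewrite exprMn EFinM.
  rewrite ge0_integralZl//; first last.
  - by move=> w _; rewrite lee_fin sqr_ge0.
  - by apply/measurable_EFinP; apply: measurable_funX; exact: measurable_funB.
  rewrite second_moment_frequency -EFinM lee_fin natrX.
  have k0 : (0 : R) < k.+1%:R ^+ 2 by rewrite exprn_gt0 ?ltr0n.
  rewrite expr2 -mulrA mulKf ?gt_eqF// ler_piMr ?invr_ge0 ?(ltW k0)//.
  by nra.
(* Exchanging sum and integral gives [sum_k Y k] a finite integral. It is then finite almost surely,
   which forces [Y k w] to tend to 0. *)
have sumY : (\int[P]_w (\sum_(k <oo) (Y k w)%:E) < +oo)%E.
  rewrite integral_nneseries//; first last.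
  - by move=> k w _; rewrite lee_fin.
  - by move=> k; exact/measurable_EFinP.
  apply: le_lt_trans (nneseries_inv_sqr_lty R); apply: lee_nneseries => [k _ _|k _].
    by apply: integral_ge0 => w _; rewrite lee_fin.
  exact: intY.
have : P.-integrable setT (fun w => \sum_(k <oo) (Y k w)%:E)%E.
  apply/integrableP; split.
    rewrite (_ : (fun w => _) = (fun w => \sum_(k <oo | k \in predT) (Y k w)%:E)%E)//.
    apply: ge0_emeasurable_sum => [k w _ _|k _]; first by rewrite lee_fin.
    exact/measurable_EFinP.
  under eq_integral => w _.
    rewrite gee0_abs; last by apply: nneseries_ge0 => k _ _; rewrite lee_fin.
    over.
  by [].
move=> /integrable_ae => /(_ measurableT); apply: filterS => w /(_ I) Yw.
have /nneseries_lty_cvg0 : (\sum_(k <oo) (Y k w)%:E < +oo)%E.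
  by rewrite ltey_eq Yw.
move=> /(_ (fun k => Y0 k w)) Yw0.
have : (n%:R^-1 * u w n) @[n --> \oo] --> 0.
  (* Each increment of [u w] is an indicator minus [q], hence at most 1 in absolute value. *)
  apply: cvg_from_squares => [n|].
    rewrite /u /S big_ord_recr /= -natr1.
    rewrite [X in `|X|](_ : _ = \1_(A n) w - q); last by ring.
    by rewrite indicE ler_norml; case: (_ \in _) => /=; apply/andP; split; lra.
  apply/cvgr0Pnorm_lt => e e0; have e20 : 0 < e ^+ 2 by rewrite exprn_gt0.
  move/cvgr0Pnorm_lt/(_ _ e20): Yw0; apply: filterS => k.
  by rewrite /Y normrX ltr_pXn2r// ?nnegrE// ltW.
move=> uw0; apply/subr_cvg0.
apply: cvg_trans uw0; apply: near_eq_cvg; near=> n.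
have n0 : n%:R != 0 :> R by rewrite pnatr_eq0 -lt0n; near: n; exact: nbhs_infty_gt.
by rewrite /u mulrBr mulKf.
Unshelve. all: by end_near. Qed.

End pairwise_independent_events.

(** * From rank bounds to limits of spectral integrals *)

(** Up to an error bounded uniformly in [n], the eigenvalue sum of [f] is that of [N n] copies of
    [b] and [n - N n] copies of [a]; division by [n] removes the error. *)
Lemma cvg_integral_two_atoms (R : realType) (A : forall n, 'M[R]_n)
    (N : nat -> nat) (K : nat) (a b t : R) (f : R -> R) :
  (forall n, (A n)^T = A n) -> (forall n, (N n <= n)%N) -> a != b ->
  (forall n, (\rank (A n - b%:M)%R <= K + (n - N n))%N) ->
  (forall n, (\rank (A n - a%:M)%R <= K + N n)%N) ->
  (n%:R^-1 * (N n)%:R) @[n --> \oo] --> t ->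
  continuous f -> (exists M : R, forall x, `|f x| <= M) ->
  (\int[spectral_distribution (A n)]_x (f x)%:E)%E @[n --> \oo] -->
    ((1 - t) * f a + t * f b)%:E.
Proof.
move=> symA Nn ab rkb rka Nt cf [M fM].
have mf : measurable_fun setT f by exact: continuous_measurable_fun.
under eq_cvg do rewrite integral_spectral_distribution//.
apply: cvg_EFin; first exact: nearW.
pose u n := \sum_(x <- eigenvalues (A n)) f x.
pose v n := (N n)%:R * f b + (n - N n)%N%:R * f a.
have uv n : `|u n - v n| <= K%:R * M *+ 4.
  have := @sum_two_atoms R f M a b (eigenvalues (A n)) (N n) K fM ab.
  rewrite size_eigenvalues//; apply => //.
    have := leq_rank_count_eigenvalues _ _ (A n) b (symA n).
    by have := rkb n; have := Nn n; lia.
  have := leq_rank_count_eigenvalues _ _ (A n) a (symA n).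
  by have := rka n; lia.
have inv0 : (n%:R^-1 : R) @[n --> \oo] --> 0.
  by rewrite -(cvg_shiftS (fun n => n%:R^-1 : R)); exact: cvg_harmonic.
have uv0 : (n%:R^-1 * (u n - v n)) @[n --> \oo] --> 0.
  apply/norm_cvg0P.
  apply: (@squeeze_cvgr _ _ _ _ (cst 0) (fun n => n%:R^-1 * (K%:R * M *+ 4))).
  - apply: nearW => n; rewrite normr_ge0 normrM ger0_norm ?invr_ge0//=.
    by rewrite ler_wpM2l ?invr_ge0.
  - exact: cvg_cst.
  - by rewrite -[X in _ --> X](mul0r (K%:R * M *+ 4)); apply: cvgMr_tmp.
have vt : (n%:R^-1 * v n) @[n --> \oo] --> (1 - t) * f a + t * f b.
  have : (1 - n%:R^-1 * (N n)%:R) * f a + (n%:R^-1 * (N n)%:R) * f b @[n --> \oo] -->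
      (1 - t) * f a + t * f b.
    apply: cvgD; apply: cvgMr_tmp => //.
    by apply: cvgB => //; exact: cvg_cst.
  apply: cvg_trans; apply: near_eq_cvg; near=> n.
  have n0 : n%:R != 0 :> R.
    by rewrite pnatr_eq0 -lt0n; near: n; exact: nbhs_infty_gt.
  by rewrite /v natrB//; field.
rewrite (_ : fine \o _ = (fun n => n%:R^-1 * (u n - v n)) \+ (fun n => n%:R^-1 * v n)).
  by rewrite -[X in _ --> X]add0r; exact: cvgD.
by apply/funext => n /=; rewrite -mulrDr subrK.
Unshelve. all: by end_near. Qed.

(** * Consequences of the hypotheses on the weights *)

(** The point masses [p i] sum to 1, so the countable set of naturals has full measure under the
    common law. *)
Lemma ae_nat_valued d (T : measurableType d) (R : realType) (P : probability T R)
    (X Y : {RV P >-> R}) (p : nat -> R) :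
  (forall i : nat, P (X @^-1` [set i%:R]) = (p i)%:E) ->
  (\sum_(0 <= i <oo) (p i)%:E)%E = 1%E -> same_law Y X ->
  {ae P, forall w, exists i : nat, Y w = i%:R}.
Proof.
move=> Pp sum1 YX; pose B := \bigcup_(i : nat) [set i%:R : R].
have mB : measurable B by apply: bigcup_measurable => i _; exact: measurable_set1.
have PB : P (Y @^-1` B) = 1%E.
  rewrite [LHS](YX B mB) /B measure_bigcup//=; last first.
    by move=> i j _ _ [x [-> /eqP]]; rewrite eqr_nat => /eqP.
  rewrite -sum1 (@eq_eseriesl _ _ xpredT) => [|i]; last by rewrite in_setT.
  by apply: eq_eseriesr => i _; exact: Pp.
exists (~` (Y @^-1` B)); split.
- by apply: measurableC; rewrite -[_ @^-1` _]setTI; exact: measurable_funP.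
- rewrite probability_setC ?PB ?subee//.
  by rewrite -[_ @^-1` _]setTI; exact: measurable_funP.
- by move=> w /= nY [i _ Yi]; apply: nY; exists i.
Qed.

(** The case [J = {i, j}] of mutual independence, in the form used by the law of large numbers. *)
Lemma mutually_independent_pair d (T : measurableType d) (R : realType)
    (P : probability T R) (I : choiceType) (Xs : I -> {RV P >-> R}) (B : set R) i j :
  mutually_independent Xs -> measurable B -> i != j ->
  P ((Xs i @^-1` B) `&` (Xs j @^-1` B)) =
    (P (Xs i @^-1` B) * P (Xs j @^-1` B))%E.
Proof.
move=> indep mB ij; have := indep [fset i; j]%fset (fun=> B) (fun=> mB).
rewrite big_fsetU1 ?inE//= big_seq_fset1 => <-; congr (P _).
apply/seteqP; split => w /=.
  by move=> [wi wj] k /=; rewrite !inE => /orP[] /eqP ->.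
by move=> wB; split; apply: wB; rewrite /= !inE eqxx ?orbT.
Qed.

(** * Almost sure convergence of both spectral distributions *)

Theorem theorem3 (R : realType) (d : measure_display) (Omega : measurableType d)
    (P : probability Omega R) (X : {RV P >-> R}) (p : nat -> R)
    (hp : forall i : nat, P (X @^-1` [set i%:R]) = (p i)%:E)
    (hsum : (\sum_(0 <= i <oo) (p i)%:E)%E = 1%E)
    (m : nat) (hm : (1 <= m)%N)
    (hpos : forall i : nat, (i <= 2 * m - 1)%N -> 0 < p i)
    (Xs : nat -> {RV P >-> R})
    (hindep : mutually_independent Xs)
    (hcopies : forall k : nat, same_law (Xs k) X) :
  let theta : R := (2 * m - 1)%N%:R in
  let F : R -> {i01 R} := cdf01 X in
  {ae P, forall w : Omega,
    weak_cvg
      (fun n => graph_spectral_distribution R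
                  (@threshold_graph R theta (fun i => Xs i w) n))
      (two_point (F (m - 1)%N%:R) (-1) 0)
    /\
    weak_cvg
      (fun n => graph_spectral_distribution R
                  (@threshold_graph_loops R theta (fun i => Xs i w) n))
      \d_(0 : R) }.
Proof.
(* A weight lies in the half-line [B] with probability [F(m - 1)]. *)
move=> theta F; pose B := [set` `]-oo, (m - 1)%N%:R]] : set R.
have mB : measurable B by exact: measurable_itv.
have PB k : P (Xs k @^-1` B) = (F (m - 1)%N%:R)%:num%:E.
  rewrite [LHS](hcopies k B mB) /F /cdf01 /= fineK// /cdf fin_num_measure//.
have : {ae P, forall w, forall k, exists i : nat, Xs k w = i%:R}.
  by apply: ae_foralln => k; exact: (ae_nat_valued _ _ _ _ _ _ _ hp).
have : {ae P, forall w, (n%:R^-1 * \sum_(i < n) \1_(Xs i @^-1` B) w) @[n --> \oo]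
    --> (F (m - 1)%N%:R)%:num}.
  apply: (slln_events _ _ _ _ (fun i => Xs i @^-1` B)) => [k|k|i j ij].
  - by rewrite -[_ @^-1` _]setTI; exact: measurable_funP.
  - exact: PB.
  - apply: etrans (mutually_independent_pair _ _ _ _ _ _ _ _ _ hindep mB ij) _.
    by rewrite EFinM; congr (_ * _)%E; exact: PB.
(* From here [w] is fixed, with natural weights [k i], and the argument is deterministic. *)
apply: filterS2 => w freq /choice[k Xk].
rewrite (_ : (fun i => Xs i w) = (fun i => (k i)%:R)); last exact/funext.
pose N n := #|[pred i : 'I_n | (k i < m)%N]|.
have Nn n : (N n <= n)%N by rewrite -[leqRHS]card_ord max_card.
have N' n : #|[pred i : 'I_n | (m <= k i)%N]| = (n - N n)%N.
  rewrite -[X in (X - _)%N](card_ord n) -(cardC [pred i : 'I_n | (k i < m)%N]).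
  by rewrite addKn; apply: eq_card => i; rewrite !inE -leqNgt.
have Nt : (n%:R^-1 * (N n)%:R) @[n --> \oo] --> (F (m - 1)%N%:R)%:num.
  rewrite (_ : (fun n => _) = (fun n => n%:R^-1 * \sum_(i < n) \1_(Xs i @^-1` B) w))//.
  apply/funext => n; congr (_ * _); rewrite /N -sum1_card natr_sum big_mkcond /=.
  apply: eq_bigr => i _; rewrite indicE.
  (* For natural weights [k i <= m - 1] is [k i < m], since [m >= 1]. *)
  have -> : (w \in Xs i @^-1` B) = (k i < m)%N.
    by apply/idP/idP; rewrite inE /B /= in_itv /= Xk ler_nat; lia.
  by rewrite inE; case: ifP.
have N10 : (-1 : R) != 0 by rewrite oppr_eq0 oner_eq0.
split=> f cf fM; have mf : measurable_fun setT f by exact: continuous_measurable_fun.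
  rewrite integral_two_point//.
  (* Atom [b = 0] receives the [N n] weights below [m], atom [a = -1] the others. *)
  apply: (@cvg_integral_two_atoms _ _ N (2 * m).+1) => // n.
  - exact: threshold_sym.
  - by rewrite -N'; exact: mxrank_threshold0.
  - exact: mxrank_thresholdN1.
rewrite integral_dirac//; last exact/measurable_EFinP.
(* The Dirac mass at 0 is treated as a two-point law with [t = 1] and [N n = n]; the atom [-1] is a
   dummy of weight 0, for which the trivial bound of the rank by [n] suffices. *)
rewrite diracT mul1e (_ : f 0 = (1 - 1) * f (-1) + 1 * f 0); last by ring.
apply: (@cvg_integral_two_atoms _ _ id (2 * m).+1) => // [n|n|n|].
- exact: threshold_loops_sym.
- by rewrite raddf0 subr0 subnn addn0; exact: mxrank_threshold_loops.
- by rewrite (leq_trans (rank_leq_row _))// leq_addl.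
- have : cst (1 : R) n @[n --> \oo] --> (1 : R) by exact: cvg_cst.
  (* The ratio [n^-1 * n] is 1 only for [n > 0], as the inverse of 0 is 0. *)
  apply: cvg_trans; apply: near_eq_cvg; near=> n.
  by rewrite mulVf// pnatr_eq0 -lt0n; near: n; exact: nbhs_infty_gt.
Unshelve. all: by end_near. Qed.
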